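(* Let $X$ be a $k$-semigraph algebra. If $X$ is free, then $X$ is cancelling.
   Context: SEMIGRAPHS. A semimultiplicative set is a set $T$ with a subset $T^{\{2\}}\subseteq T\times T$ and a multiplication $T^{\{2\}}\to T$, $(s,t)\mapsto st$, that is associative: for all $s,t,u\in T$, $(st)u$ is defined if and only if $s(tu)$ is defined, and both are equal if defined. Let $k$ be an index set (a natural number if finite). A $k$-semigraph is a semimultiplicative set $T$ with a degree map $d:T\to\mathbb{N}_0^k$ such that (1) $d(xy)=d(x)+d(y)$ whenever $xy$ is defined, and (2) whenever $d(x)=n_1+n_2$ with $n_1,n_2\in\mathbb{N}_0^k$ there are unique $x_1,x_2\in T$ with $x=x_1x_2$, $d(x_1)=n_1$, $d(x_2)=n_2$. With $\vee$ the coordinatewise maximum, $T^{(\min)}(x,y)=\{(\alpha,\beta)\in T\times T\mid x\alpha, y\beta \text{ defined},\ x\alpha=y\beta,\ d(x\alpha)=d(x)\vee d(y)\}$; $T$ is finitely aligned if all these sets are finite. $T$ is non-unital if $T=T_1\setminus\{1\}$ for a $k$-semigraph $T_1$ with unit $1$. ALGEBRAS. In a $*$-algebra (over $\mathbb{C}$, with involution), $s$ is a partial isometry if $ss^*s=s$, a projection is $p=p^2=p^*$; $P_a=aa^*$, $Q_a=a^*a$; for projections $p\le q$ means $pq=p$, and $p<q$ means $p\le q$, $p\ne q$; $\bigvee$ is the supremum of commuting projections ($p\vee q=p+q-pq$). SEMIGRAPH ALGEBRAS. Given disjoint $\mathcal{P},\mathcal{T}$ with $\mathcal{T}$ a non-unital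 $k$-semigraph, $\mathcal{T}_1=\mathcal{T}\sqcup\{1\}$; $\mathbb{F}$ is the free non-unital $*$-algebra on $\mathcal{P}\cup\mathcal{T}$. A word is a $*$-monomial in the letters $\mathcal{P}\cup\mathcal{T}$. The degree of a word is the sum of the degrees of its letters, where $t\in\mathcal{T}$ has its semigraph degree, $p\in\mathcal{P}$ has degree $0$ and $d(x^* )=-d(x)$. The fiber space of $\mathbb{F}$ is the union over $n\in\mathbb{Z}^k$ of the linear spans of the words of degree $n$. A $k$-semigraph algebra is a $*$-algebra $X$ generated by disjoint subsets $\mathcal{P},\mathcal{T}$ such that: (i) $\mathcal{P}$ is a set of commuting projections closed under multiplication; (ii) $\mathcal{T}$ is a set of nonzero partial isometries closed under nonzero products; (iii) $\mathcal{T}$ is a non-unital finitely aligned $k$-semigraph; (iv) for all $x\in\mathcal{T}$, $p\in\mathcal{P}$ there is $q\in\mathcal{P}$ with $px=xq$; (v) for all $x,y\in\mathcal{T}$ there are $q_{x,y,\alpha,\beta}\in\mathcal{P}$ with $x^*y=\sum_{(\alpha,\beta)\in\mathcal{T}_1^{(\min)}(x,y)}\alpha q_{x,y,\alpha,\beta}\beta^*$ (the unit $1$ of $\mathcal{T}_1$ acting as unit on $X$); (vi) $X$ is canonically isomorphic to the quotient of $\mathbb{F}$ by a subset of the fiber space. Standard words are the elements $spt^*$ of $X$ ($s,t\in\mathcal{T}_1$, $p\in\mathcal{P}$), of degree $d(s)-d(t)$; half-standard words are the elements $sp$. A standard projection is an element $P_x(1-P_{y_1})\cdots(1-P_{y_m})$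 of $X$ with $x,y_i$ half-standard words, $m\ge0$. All words form an inverse semigroup of partial isometries, so their range projections commute. $X$ is free if (i) $P_a\notin\mathcal{P}$ for every half-standard word $a\notin\mathcal{P}$, and (ii) if $p\in\mathcal{P}$ and $a_1,\ldots,a_n$ are half-standard words with $P_{a_i}<p$ for all $1\le i\le n$, then $\bigvee_{i=1}^nP_{a_i}<p$. $X$ is cancelling if for every standard word $w$ with nonzero degree and every nonzero standard projection $p$ there is a nonzero standard projection $q$ such that $q\le p$ and $qwq=0$. *)

(* Defs.v *)
From HB Require Import structures.
From mathcomp Require Import all_boot all_order all_algebra.
From mathcomp Require Import finmap.
From mathcomp Require Import mathcomp_extra boolp classical_sets functions.
From mathcomp Require Import cardinality fsbigop reals.
From mathcomp Require Import complex monalg.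

Set Implicit Arguments.
Unset Strict Implicit.
Unset Printing Implicit Defensive.

Import Order.TTheory GRing.Theory Num.Theory.

Local Open Scope classical_set_scope.
Local Open Scope ring_scope.

(* Multiplication is not required to have a unit. *)
HB.mixin Record Lmodule_isStarAlgebra (R : realType) X
    of GRing.Lmodule R[i] X := {
  amul : X -> X -> X;
  star : X -> X;
  amulA : associative amul;
  amulDl : left_distributive amul +%R;
  amulDr : right_distributive amul +%R;
  amulZl : forall (c : R[i]) x y, amul (c *: x) y = c *: amul x y;
  amulZr : forall (c : R[i]) x y, amul x (c *: y) = c *: amul x y;
  starK : involutive star;
  starD : {morph star : x y / x + y};
  starZ : forall (c : R[i]) x, star (c *: x) = c^* *: star x;
  starM : forall x y, star (amul x y) = amul (star y) (star x)
}.

#[short(type="starAlgType")]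
HB.structure Definition StarAlgebra (R : realType) :=
  { X of Lmodule_isStarAlgebra R X & GRing.Lmodule R[i] X }.

Notation "x ** y" := (amul x y)
  (at level 40, left associativity) : ring_scope.

Section StarAlgebraTheory.
Variables (R : realType) (X : starAlgType R).
Implicit Types (x y p q : X) (B : set X).

Definition partial_isometry x := x ** star x ** x = x.
Definition projection p := p ** p = p /\ star p = p.

Definition range_proj x := x ** star x.

Definition proj_le p q := p ** q = p.
Definition proj_lt p q := proj_le p q /\ p <> q.
Definition proj_join p q := p + q - p ** q.

Definition star_subalgebra B :=
  [/\ B 0, (forall x y, B x -> B y -> B (x + y)),
      (forall (c : R[i]) x, B x -> B (c *: x)),
      (forall x y, B x -> B y -> B (x ** y)) &
      (forall x, B x -> B (star x))].

Definition generated_by (G : set X) :=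
  forall B, star_subalgebra B -> G `<=` B -> B = setT.

End StarAlgebraTheory.

(* A partial multiplication on T is a map [T -> T -> option T], with value
   None where the product is undefined. *)
Section Semigraphs.
Variable k : Type.

Definition semimultiplicative (T : Type) (m : T -> T -> option T) :=
  forall s t u, obind (fun st => m st u) (m s t) = obind (m s) (m t u).

Definition semigraph (T : Type) (m : T -> T -> option T)
    (d : T -> k -> nat) :=
  [/\ semimultiplicative m,
      (forall x y z, m x y = Some z -> d z = (fun i => (d x i + d y i)%N)) &
      (forall x (n1 n2 : k -> nat), d x = (fun i => (n1 i + n2 i)%N) ->
         exists! x12 : T * T,
           [/\ m x12.1 x12.2 = Some x, d x12.1 = n1 & d x12.2 = n2])].

(* T_1 = T + {1} is [option T], where None is the adjoined unit. *)
Definition mul1 (T : Type) (m : T -> T -> option T) (x y : option T) :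
    option (option T) :=
  match x, y with
  | None, _ => Some y
  | _, None => Some x
  | Some s, Some t => omap Some (m s t)
  end.

(* The unit of a semigraph has degree 0, since d(1) = d(1) + d(1). *)
Definition deg1 (T : Type) (d : T -> k -> nat) (x : option T) : k -> nat :=
  if x is Some t then d t else (fun _ => 0%N).

(* T is T_1 \ {1} for a semigraph T_1 with unit 1: a product of elements of
   T is never 1, as 1 is the only element of T_1 of degree 0. *)
Definition nonunital_semigraph (T : Type) (m : T -> T -> option T)
    (d : T -> k -> nat) :=
  semigraph (mul1 m) (deg1 d).

Definition min_ext (T : Type) (m : T -> T -> option T) (d : T -> k -> nat)
    (x y : T) : set (T * T) :=
  [set ab | exists z, [/\ m x ab.1 = Some z, m y ab.2 = Some z &
                          d z = (fun i => maxn (d x i) (d y i))]].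

Definition finitely_aligned (T : Type) (m : T -> T -> option T)
    (d : T -> k -> nat) :=
  forall x y, finite_set (min_ext m d x y).

End Semigraphs.

(* The free unital *-algebra on L is the monoid algebra of the words in the
   letters [(l, false)], standing for l, and [(l, true)], standing for l^*;
   the free non-unital one consists of its elements without constant term. *)
Section FreeStarAlgebra.
Variables (R : realType) (L : choiceType).

Definition letter := (L * bool)%type.
Definition free1 := {malg R[i][{fmonom letter}]}.
Implicit Types (f g : free1) (I S : set free1).

Definition free_nonunital : set free1 := [set f : free1 | f@_mone = 0].

Definition word_star (w : {fmonom letter}) : {fmonom letter} :=
  FMonom (rev [seq (l.1, ~~ l.2) | l <- fmonom_val w]).

Definition free_star f : free1 :=
  \sum_(w <- msupp f) << (f@_w)^* *g word_star w >>.

Definition star_ideal I :=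
  [/\ I `<=` free_nonunital,
      I 0,
      (forall f g, I f -> I g -> I (f + g)),
      (forall (c : R[i]) f, I f -> I (c *: f)) &
      (forall f, I f -> I (free_star f)) /\
      (forall f g, free_nonunital f -> I g -> I (f * g) /\ I (g * f))].

Definition star_ideal_gen S : set free1 :=
  [set f : free1 | forall I, star_ideal I -> S `<=` I -> I f].

Section Degree.
Variables (k : Type) (d : L -> k -> nat).

Definition word_deg (w : {fmonom letter}) : k -> int :=
  fun i => \sum_(l <- fmonom_val w)
             (if l.2 then - (d l.1 i)%:Z else (d l.1 i)%:Z).

Definition fiber_space : set free1 :=
  [set f : free1 | free_nonunital f /\
     exists n : k -> int, forall w, w \in msupp f -> word_deg w = n].

End Degree.

Section Evaluation.
Variables (X : starAlgType R) (h : L -> X).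

Definition letter_val (l : letter) : X :=
  if l.2 then star (h l.1) else h l.1.

(* The value at the empty word is never used. *)
Definition word_val (w : {fmonom letter}) : X :=
  if fmonom_val w is l :: w' then
    foldl (fun x l' => x ** letter_val l') (letter_val l) w'
  else 0.

Definition free_val f : X := \sum_(w <- msupp f) f@_w *: word_val w.

End Evaluation.

End FreeStarAlgebra.

Section SemigraphAlgebras.
Variables (R : realType) (k : Type) (X : starAlgType R).
Variables (P T : set X) (d : T -> k -> nat).

(* The multiplication of X restricted to T, defined where the product lies
   in T, i.e. (under sga_Tmul below) where it is nonzero. *)
Definition sgmul (s t : T) : option T := insub (val s ** val t).

(* Multiplication by s and by t^* for s, t in T_1, where 1 acts trivially. *)
Definition lmul1 (s : option T) (x : X) : X :=
  if s is Some s' then val s' ** x else x.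
Definition rmul1_star (x : X) (t : option T) : X :=
  if t is Some t' then x ** star (val t') else x.

Definition standard_word (s : option T) (p : X) (t : option T) : X :=
  rmul1_star (lmul1 s p) t.

Definition half_standard (a : X) :=
  exists s : option T, exists2 p, P p & a = lmul1 s p.

Definition standard_projection (q : X) :=
  exists (x : X) (ys : seq X),
    [/\ half_standard x, (forall y, y \in ys -> half_standard y) &
        q = foldl (fun z y => z - z ** range_proj y) (range_proj x) ys].

Definition gen_letter : choiceType := (P + T)%type.
Definition gen_val (l : gen_letter) : X :=
  match l with inl p => val p | inr t => val t end.
Definition gen_deg (l : gen_letter) : k -> nat :=
  match l with inl _ => (fun _ => 0%N) | inr t => d t end.

Record semigraph_algebra : Prop := SemigraphAlgebra {
  sga_disjoint : P `&` T = set0;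
  sga_generated : generated_by (P `|` T);
  sga_Pproj : forall p, P p -> projection p;
  sga_Pcomm : forall p q, P p -> P q -> p ** q = q ** p;
  sga_Pmul : forall p q, P p -> P q -> P (p ** q);
  sga_Tpi : forall t, T t -> t <> 0 /\ partial_isometry t;
  sga_Tmul : forall s t, T s -> T t -> s ** t <> 0 -> T (s ** t);
  sga_semigraph : nonunital_semigraph sgmul d;
  sga_aligned : finitely_aligned sgmul d;
  sga_PT : forall x p, T x -> P p -> exists2 q, P q & p ** x = x ** q;
  (* the sum ranges over a finite set by sga_aligned *)
  sga_TT : forall x y : T,
    let M := min_ext (mul1 sgmul) (deg1 d) (Some x) (Some y) in
    exists q : option T * option T -> X,
      (forall ab, M ab -> P (q ab)) /\
      star (val x) ** val y =
        \sum_(ab \in M) standard_word ab.1 (q ab) ab.2;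
  (* the canonical map from the free non-unital *-algebra on P and T to X,
     onto by sga_generated, has kernel the *-ideal generated by S *)
  sga_presented : exists2 S : set (free1 R gen_letter),
    S `<=` fiber_space gen_deg &
    forall f, free_nonunital f ->
      free_val gen_val f = 0 <-> star_ideal_gen S f
}.

(* The family a_1, ..., a_n is non-empty: n = 0 would only forbid 0 in P. *)
Definition free_semigraph_algebra :=
  (forall a, half_standard a -> ~ P a -> ~ P (range_proj a)) /\
  (forall p (s : seq X), P p -> s <> [::] ->
     (forall a, a \in s -> half_standard a /\ proj_lt (range_proj a) p) ->
     proj_lt (\big[@proj_join R X/0]_(a <- s) range_proj a) p).

Definition cancelling :=
  forall (s t : option T) (r : X), P r -> deg1 d s <> deg1 d t ->
  forall p, standard_projection p -> p <> 0 ->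
  exists q, [/\ standard_projection q, q <> 0, proj_le q p &
                q ** standard_word s r t ** q = 0].

End SemigraphAlgebras.

(* Main.v *)
(* Let p = P_x (1 - P_{y_1}) ... (1 - P_{y_m}) be a nonzero standard projection,
   with x = a q, q in P and q <= Q_a. Each P_y acts on the image of a q through
   finitely many range projections P_c < q of half-standard c, so by freeness p
   remains nonzero after removing further ranges P_{a b} with b half-standard
   and P_b < q. By (v), q a^* w a q is a finite sum of standard words s r t^* of
   the same nonzero degree as w, hence s or t differs from 1, and removing the
   range of a q s r, respectively of a q t r, kills this summand. For s in T the
   element b = q s r does satisfy P_b < q: if s r is not in P this is part (i)
   of freeness, and if it is, the grading of X given by (vi) forces s r = 0. *)
Require Import Defs.
From mathcomp Require Import all_boot all_order all_algebra.
From mathcomp Require Import finmap.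
From mathcomp Require Import boolp classical_sets fsbigop reals.
From mathcomp Require Import complex monalg zify.

Set Implicit Arguments.
Unset Strict Implicit.
Unset Printing Implicit Defensive.

Import Order.TTheory GRing.Theory Num.Theory.

Local Open Scope classical_set_scope.
Local Open Scope ring_scope.

(** * Computation rules in a star-algebra without unit *)

Section StarAlgebraFacts.
Variables (R : realType) (X : starAlgType R).
Implicit Types x y z p q : X.

Lemma amul0l x : 0 ** x = 0.
Proof. by rewrite -(scale0r (0 : X)) amulZl !scale0r. Qed.

Lemma amul0r x : x ** 0 = 0.
Proof. by rewrite -(scale0r (0 : X)) amulZr !scale0r. Qed.

Lemma amulNl x y : (- x) ** y = - (x ** y).
Proof. by rewrite -scaleN1r amulZl scaleN1r. Qed.

Lemma amulNr x y : x ** (- y) = - (x ** y).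
Proof. by rewrite -scaleN1r amulZr scaleN1r. Qed.

Lemma amulBl x y z : (x - y) ** z = x ** z - y ** z.
Proof. by rewrite amulDl amulNl. Qed.

Lemma amulBr x y z : x ** (y - z) = x ** y - x ** z.
Proof. by rewrite amulDr amulNr. Qed.

Lemma star0 : star (0 : X) = 0.
Proof. by apply: (addrI (star (0 : X))); rewrite -starD !addr0. Qed.

Lemma starN x : star (- x) = - star x.
Proof. by apply: (addrI (star x)); rewrite -starD !subrr star0. Qed.

Lemma starB x y : star (x - y) = star x - star y.
Proof. by rewrite starD starN. Qed.

Lemma amul_suml I (r : seq I) (Q : pred I) (F : I -> X) x :
  (\sum_(i <- r | Q i) F i) ** x = \sum_(i <- r | Q i) F i ** x.
Proof.
exact: (big_morph (fun z => z ** x) (fun y z => amulDl y z x) (amul0l x)).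
Qed.

Lemma amul_sumr I (r : seq I) (Q : pred I) (F : I -> X) x :
  x ** (\sum_(i <- r | Q i) F i) = \sum_(i <- r | Q i) x ** F i.
Proof. exact: (big_morph (amul x) (amulDr x) (amul0r x)). Qed.

Lemma star_sum I (r : seq I) (Q : pred I) (F : I -> X) :
  star (\sum_(i <- r | Q i) F i) = \sum_(i <- r | Q i) star (F i).
Proof. exact: (big_morph (@star R X) (@starD R X) star0). Qed.

End StarAlgebraFacts.

(** * Evaluation of the free star-algebra as a star-homomorphism *)

Section FreeEvaluation.
Variables (R : realType) (L : choiceType) (X : starAlgType R) (h : L -> X).
Implicit Types (f g : free1 R L) (w : {fmonom (letter L)}).

Lemma free_nonunitalD f g :
  free_nonunital f -> free_nonunital g -> free_nonunital (f + g).
Proof.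
by move=> f1 g1; rewrite /free_nonunital /= mcoeffD f1 g1 addr0.
Qed.

Lemma free_nonunitalU (c : R[i]) w :
  (0 < size (fmonom_val w))%N -> free_nonunital << c *g w >>.
Proof.
move=> w_gt0; rewrite /free_nonunital /= mcoeffU; case: eqP => // w0.
by move: w_gt0; rewrite w0 fm1.
Qed.

(** Allows the values of f, g and f + g to be written as sums over one common set of words. *)
Lemma free_val_widen f (D : {fset {fmonom (letter L)}}) :
  (msupp f `<=` D)%fset ->
  free_val h f = \sum_(w <- D) f@_w *: word_val h w.
Proof.
move=> fD; rewrite /free_val; apply: big_fset_incl => // w _.
by rewrite -mcoeff_eq0 => /eqP ->; rewrite scale0r.
Qed.

Lemma free_valD f g : free_val h (f + g) = free_val h f + free_val h g.
Proof.
rewrite (free_val_widen (msuppD_le f g)).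
rewrite (free_val_widen (fsubsetUl (msupp f) (msupp g))).
rewrite (free_val_widen (fsubsetUr (msupp f) (msupp g))) -big_split /=.
by apply: eq_bigr => w _; rewrite mcoeffD scalerDl.
Qed.

Lemma free_valZ c f : free_val h (c *: f) = c *: free_val h f.
Proof.
rewrite (free_val_widen (msuppZ_le c f)) /free_val scaler_sumr.
by apply: eq_bigr => w _; rewrite mcoeffZ scalerA.
Qed.

Lemma free_val0 : free_val h 0 = 0.
Proof. by rewrite /free_val msupp0 big_seq_fset0. Qed.

Lemma free_val_sum I (r : seq I) (Q : pred I) (F : I -> free1 R L) :
  free_val h (\sum_(i <- r | Q i) F i) = \sum_(i <- r | Q i) free_val h (F i).
Proof. exact: (big_morph (free_val h) free_valD free_val0). Qed.

Lemma free_valU (c : R[i]) w : free_val h << c *g w >> = c *: word_val h w.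
Proof. by rewrite (free_val_widen msuppU_le) big_seq_fset1 mcoeffUU. Qed.

(** Empty words are excluded because [word_val] gives them the default value 0 instead of a unit. *)
Lemma word_valM s1 s2 : s1 <> [::] -> s2 <> [::] ->
  word_val h (FMonom (s1 ++ s2)) =
  word_val h (FMonom s1) ** word_val h (FMonom s2).
Proof.
case: s1 => // l1 s1 _; case: s2 => // l2 s2 _;
  rewrite /word_val /= foldl_cat /=.
elim/last_ind: s2 => [|s2 l IH] //=.
by rewrite !foldl_rcons IH amulA.
Qed.

Lemma star_word_val w : word_val h (word_star w) = star (word_val h w).
Proof.
case: w; rewrite /word_star /=; elim=> [|l s IH];
  first by rewrite /word_val /= star0.
have lE : word_val h (FMonom [:: (l.1, ~~ l.2)]) = star (letter_val h l).
  by rewrite /word_val /letter_val /=; case: l.2; rewrite ?starK.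
case: (eqVneq s [::]) => [-> //|/eqP sN].
rewrite -[l :: s]cat1s word_valM// starM map_cat rev_cat -[LHS]/(word_val h
  (FMonom (_ ++ _))).
rewrite word_valM ?IH ?lE //.
by case: (s) sN => // l' s' _ /(congr1 size); rewrite size_rev.
Qed.

Lemma free_valM f g : free_nonunital f -> free_nonunital g ->
  free_val h (f * g) = free_val h f ** free_val h g.
Proof.
move=> f1 g1; rewrite malgME free_val_sum [free_val h f]/free_val amul_suml.
apply: eq_big_seq => w1 w1f; rewrite [free_val h g]/free_val free_val_sum
  amul_sumr.
apply: eq_big_seq => w2 w2g; rewrite free_valU amulZl amulZr scalerA;
  congr (_ *: _).
have ne (f' : free1 R L) w : free_nonunital f' -> w \in msupp f' ->
    fmonom_val w <> [::].
  move=> f'1; rewrite -mcoeff_neq0 => /negP wf' w0; apply: wf'.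
  rewrite -[X in _ == X]f'1; apply/eqP; congr mcoeff; apply: val_inj.
  exact: etrans w0 (esym fm1).
have -> : mmul w1 w2 = FMonom (fmonom_val w1 ++ fmonom_val w2).
  by rewrite -fmE.
rewrite word_valM; [|exact: ne w1f|exact: ne w2g].
by case: (w1); case: (w2).
Qed.

Lemma free_val_star f : free_val h (free_star f) = star (free_val h f).
Proof.
rewrite /free_star free_val_sum star_sum; apply: eq_bigr => w _.
by rewrite free_valU starZ star_word_val.
Qed.

(** Used to test membership: an evaluation vanishing on S vanishes on the star-ideal generated by
    S. *)
Lemma free_val_ker_ideal :
  star_ideal [set f | free_nonunital f /\ free_val h f = 0].
Proof.
split=> [f []//|||c f [f1 f0]|].
- by split; [rewrite /free_nonunital /= mcoeff0 | exact: free_val0].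
- move=> f g [/= f1 f0] [/= g1 g0]; split.
    by rewrite /free_nonunital /= mcoeffD f1 g1 addr0.
  by rewrite free_valD f0 g0 addr0.
- split; last by rewrite free_valZ f0 scaler0.
  by rewrite /free_nonunital /= mcoeffZ f1 mulr0.
split=> [f [f1 f0]|f g f1 [g1 g0]]; split=> /=.
- rewrite /free_nonunital /= raddf_sum /= big1_seq// => w /andP[_ wf].
  rewrite mcoeffU; case: eqP => //= w0; move: wf; rewrite -mcoeff_neq0 =>
    /negP[].
  rewrite -[X in _ == X]f1; apply/eqP; congr mcoeff; apply: val_inj.
  move/(congr1 (@fmonom_val _)): w0; rewrite fm1 /word_star /=.
  move=> w0; apply: etrans (esym fm1); move: w0.
  move/(congr1 size); rewrite size_rev size_map.
  by case: w => -[].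
- by rewrite free_val_star f0 star0.
- split; last by rewrite free_valM// g0 amul0r.
  by rewrite /free_nonunital /= [LHS]rmorphM /= f1 mul0r.
- split; last by rewrite free_valM// g0 amul0l.
  by rewrite /free_nonunital /= [LHS]rmorphM /= g1 mul0r.
Qed.

End FreeEvaluation.

(** The same f serves all h, so that the canonical evaluation and a gauged one can be compared at
    f. *)
Lemma ex_word_sub (R : realType) (L : choiceType) (X : starAlgType R)
    (w1 w2 : {fmonom (letter L)}) :
  (0 < size (fmonom_val w1))%N -> (0 < size (fmonom_val w2))%N ->
  exists2 f : free1 R L, free_nonunital f &
    forall h : L -> X, free_val h f = word_val h w1 - word_val h w2.
Proof.
move=> w1_gt0 w2_gt0; exists (<< 1 *g w1 >> + << -1 *g w2 >>).
  by apply: free_nonunitalD; exact: free_nonunitalU.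
by move=> h; rewrite free_valD !free_valU scale1r scaleN1r.
Qed.

(** * The gauge action on evaluations *)

Section Gauge.
Variables (R : realType) (L : choiceType) (k : Type) (X : starAlgType R).
Variables (h : L -> X) (deg : L -> k -> nat) (i : k) (z : R[i]).
Hypothesis z1 : `|z| = 1.

Definition gauge (l : L) : X := z ^+ deg l i *: h l.

Lemma word_val_gauge (w : {fmonom (letter L)}) :
  word_val gauge w = z ^ word_deg deg w i *: word_val h w.
Proof.
have z0 : z != 0 by rewrite -normr_eq0 z1 oner_eq0.
(* Since conjugation inverts z, a starred letter is scaled by z to the power of its negative
   degree. *)
have conjz : z^* = z^-1 by rewrite invC_norm z1 expr1n invr1 mul1r.
have letterE (l : letter L) : letter_val gauge l =
    z ^ (if l.2 then - (deg l.1 i)%:Z else (deg l.1 i)%:Z) *: letter_val h l.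
  rewrite /letter_val /gauge; case: l.2 => //.
  by rewrite starZ rmorphXn /= conjz exprVn exprnN.
case: w; elim/last_ind=> [|s l IH].
  by rewrite /word_val /= scaler0.
have lE g : word_val g (FMonom [:: l]) = letter_val g l by [].
case: (eqVneq s [::]) => [->|/eqP sN].
  by rewrite /= !lE letterE /word_deg /= big_seq1.
rewrite -cats1 !word_valM// IH !lE letterE amulZl amulZr scalerA.
by congr (_ *: _); rewrite /word_deg big_cat big_seq1 expfzDr.
Qed.

(** All words of f have the same degree n, so the gauge multiplies the value of f by the single
    scalar z^(n i). *)
Lemma free_val_gauge (f : free1 R L) : fiber_space deg f ->
  free_val h f = 0 -> free_val gauge f = 0.
Proof.
case=> _ [n fn] f0; rewrite -[RHS](scaler0 _ (z ^ n i)) -f0 /free_val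
  scaler_sumr.
apply: eq_big_seq => w wf.
by rewrite word_val_gauge (fn _ wf) scalerA mulrC -scalerA.
Qed.

End Gauge.

(** * A degree obstruction to t q lying in P *)

Section SemigraphAlgebraFacts.
Variables (R : realType) (k : Type) (X : starAlgType R).
Variables (P T : set X) (d : T -> k -> nat).
Hypothesis sgaX : semigraph_algebra P d.

(* The gauge automorphism t |-> z^(d t i) t, with z^(d t i) = -1, turns
   [t q = p] into [t q = - p]. *)
Lemma mul_TP_in_P (t : T) (p q : X) (Pp : P p) (Pq : P q) :
  d t <> (fun=> 0%N) -> val t ** q = p -> p = 0.
Proof.
move=> dt tq.
have [i di] : exists i, d t i != 0%N.
  apply: contrapT => /forallNP dt0; apply: dt; apply/funext => i.
  by apply/eqP/negP => di; apply: (dt0 i); exact/negP.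
have d_gt0 : (0 < d t i)%N by rewrite lt0n.
pose z : R[i] := (d t i).-root (-1).
have zd : z ^+ d t i = -1 by rewrite rootCK.
have z1 : `|z| = 1.
  apply/eqP; rewrite -(@pexpr_eq1 _ _ (d t i))// -normrX zd normrN1//.
have [S Sfib kerS] := sga_presented sgaX.
pose lt : gen_letter P T := inr t.
pose lp (r : X) (Pr : P r) : gen_letter P T := inl (SigSub (mem_set Pr)).
pose w1 : {fmonom (letter (gen_letter P T))} :=
  FMonom [:: (lt, false); (lp _ Pq, false)].
pose w2 : {fmonom (letter (gen_letter P T))} := FMonom [:: (lp _ Pp, false)].
have [f f1 fE] := @ex_word_sub R _ X w1 w2 isT isT.
have v1 : word_val (@gen_val _ _ P T) w1 = val t ** q by [].
have v2 : word_val (@gen_val _ _ P T) w2 = p by [].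
have f0 : free_val (gen_val (T := T)) f = 0 by rewrite fE v1 v2 tq subrr.
(* By the presentation, f lies in every star-ideal containing S. The kernel of the gauged evaluation
   is one, because S lies in the fiber space. *)
have /(_ _ (free_val_ker_ideal (gauge (@gen_val _ _ P T) (gen_deg d) i z))) :=
  (kerS f f1).1 f0.
case=> [g Sg|_].
  have [g1 _] := Sfib g Sg; split=> //.
  apply: free_val_gauge => //; first exact: Sfib.
  by apply/(kerS g g1) => I _; exact.
rewrite fE !word_val_gauge// v1 v2 tq /word_deg /= !big_cons !big_nil /= !addr0.
rewrite expr0z scale1r -exprnP zd scaleN1r => /eqP.
by rewrite -opprD oppr_eq0 -mulr2n -scaler_nat scaler_eq0 pnatr_eq0 => /eqP.
Qed.

(** * Multiplication by elements of T_1 and by their adjoints *)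

Implicit Types (a b s t : option T) (x y z p q : X).

Local Notation mul := (mul1 (@sgmul R X T)).

Definition lmul1_star t x : X :=
  if t is Some t' then star (val t') ** x else x.

Lemma lmul1A s x y : lmul1 s x ** y = lmul1 s (x ** y).
Proof. by case: s => //= s; rewrite amulA. Qed.

Lemma amul_rmul1_star x y t : x ** rmul1_star y t = rmul1_star (x ** y) t.
Proof. by case: t => //= t; rewrite amulA. Qed.

Lemma rmul1_star_lmul1 s x t :
  rmul1_star (lmul1 s x) t = lmul1 s (rmul1_star x t).
Proof. by case: t => //= t; rewrite lmul1A. Qed.

Lemma star_lmul1 s x : star (lmul1 s x) = rmul1_star (star x) s.
Proof. by case: s => //= s; rewrite starM. Qed.

Lemma star_rmul1_star x t : star (rmul1_star x t) = lmul1 t (star x).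
Proof. by case: t => //= t; rewrite starM starK. Qed.

Lemma rmul1_starA x t y : rmul1_star x t ** y = x ** lmul1_star t y.
Proof. by case: t => //= t; rewrite amulA. Qed.

Lemma lmul1_starA t x y : lmul1_star t x ** y = lmul1_star t (x ** y).
Proof. by case: t => //= t; rewrite amulA. Qed.

Lemma lmul10 s : lmul1 s (0 : X) = 0.
Proof. by case: s => //= s; rewrite amul0r. Qed.

Lemma rmul1_star0 s : rmul1_star (0 : X) s = 0.
Proof. by case: s => //= s; rewrite amul0l. Qed.

Lemma lmul1_star0 s : lmul1_star s 0 = 0.
Proof. by case: s => //= s; rewrite amul0r. Qed.

Lemma lmul1_sum s I (r : seq I) (F : I -> X) :
  lmul1 s (\sum_(i <- r) F i) = \sum_(i <- r) lmul1 s (F i).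
Proof. by case: s => //= s; rewrite amul_sumr. Qed.

Lemma rmul1_star_sum s I (r : seq I) (F : I -> X) :
  rmul1_star (\sum_(i <- r) F i) s = \sum_(i <- r) rmul1_star (F i) s.
Proof. by case: s => //= s; rewrite amul_suml. Qed.

Lemma lmul1_lmul1 s t u x : mul s t = Some u ->
  lmul1 s (lmul1 t x) = lmul1 u x.
Proof.
case: s t => [s|] [t|] /=; try by case=> <-.
rewrite /sgmul; case: insubP => //= st _ stE [<-].
by rewrite /= stE amulA.
Qed.

(** If s t is undefined, the product in X lies outside T; as T is closed under nonzero products, it
    is 0. *)
Lemma lmul1_lmul1_eq0 s t x : mul s t = None ->
  lmul1 s (lmul1 t x) = 0.
Proof.
case: s t => [s|] [t|] //=; rewrite /sgmul; case: insubP => //= st _.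
rewrite amulA; case: (eqVneq (val s ** val t) 0) => [->|];
  first by rewrite amul0l.
move=> /eqP st0; case/negP: st; apply/mem_set/(sga_Tmul sgaX) => //;
  exact/set_mem/valP.
Qed.

(** * Commutation with P, source projections and products of standard words *)

Lemma Pidem p : P p -> p ** p = p. Proof. by case/(sga_Pproj sgaX). Qed.
Lemma Pstar p : P p -> star p = p. Proof. by case/(sga_Pproj sgaX). Qed.

Lemma P_lmul1 s p : P p ->
  exists2 q, P q & forall x, p ** lmul1 s x = lmul1 s (q ** x).
Proof.
case: s => [s|] Pp /=; last by exists p.
have [q Pq pq] := sga_PT sgaX (set_mem (valP s)) Pp.
by exists q => // x; rewrite !amulA pq.
Qed.

Lemma P_rmul1_star s p : P p ->
  exists2 q, P q & forall x, rmul1_star x s ** p = rmul1_star (x ** q) s.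
Proof.
move=> Pp; have [q Pq pq] := P_lmul1 s Pp; exists q => // x.
have := congr1 (@star R X) (pq (star x)).
by rewrite starM !star_lmul1 starM !starK !Pstar.
Qed.

Lemma deg1_mul1 s t u i : mul s t = Some u ->
  deg1 d u i = (deg1 d s i + deg1 d t i)%N.
Proof. by have [_ + _] := sga_semigraph sgaX; move=> /[apply] ->. Qed.

(** For t of degree 0 = 0 + 0, both t 1 and 1 t are admissible factorizations; uniqueness forces t =
    1. *)
Lemma deg1_eq0 s : deg1 d s = (fun=> 0%N) -> s = None.
Proof.
case: s => // t t0; have [_ _ fact] := sga_semigraph sgaX.
have [s12 [_ uniq12]] := fact (Some t) (fun=> 0%N) (fun=> 0%N) t0.
have E1 : s12 = (Some t, None) by apply: uniq12.
have E2 : s12 = (None, Some t) by apply: uniq12.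
by rewrite E1 in E2.
Qed.

(** In (v) for t^* t only the pair (1, 1) occurs: a minimal extension t alpha has degree d(t), so
    alpha has degree 0. Hence t^* t is a single element of P. *)
Lemma source_proj_P (t : T) : P (star (val t) ** val t).
Proof.
have [q [Pq ->]] := sga_TT sgaX t t; set M := min_ext _ _ _ _.
have MN : M (None, None).
  by exists (Some t); split=> //=; apply/funext => i; rewrite maxnn.
suff -> : M = [set (None, None)] by rewrite fsbig_set1; exact: Pq.
apply/seteqP; split=> [[s1 s2]|_ -> //] [u /= [m1 m2 du]].
have deg0 s : mul (Some t) s = Some u -> s = None.
  move=> ms; apply: deg1_eq0; apply/funext => i.
  have := deg1_mul1 i ms; rewrite du maxnn => /eqP.
  by rewrite -[X in X == _]addn0 eqn_add2l => /eqP.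
by rewrite (deg0 _ m1) (deg0 _ m2).
Qed.

(** For a in T take p1 = Q_a p, which is in P by [source_proj_P]; for a = 1 take p1 = p. The last
    two clauses say p1 <= Q_a without naming Q_a. *)
Lemma half_standard_source a p : P p ->
  exists p1, [/\ P p1, lmul1 a p = lmul1 a p1,
    forall x, lmul1_star a (lmul1 a (p1 ** x)) = p1 ** x &
    forall x, p1 ** lmul1_star a (lmul1 a x) = p1 ** x].
Proof.
case: a => [t|] Pp /=; last by exists p.
have PQ := source_proj_P t; have [_ tpi] := sga_Tpi sgaX (set_mem (valP t)).
have QQ := Pidem PQ; have Qp := sga_Pcomm sgaX PQ Pp.
exists (star (val t) ** val t ** p); split; first exact: (sga_Pmul sgaX).
- by rewrite !amulA tpi.
- move=> x; set Q := star _ ** _ in QQ *.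
  by rewrite /= (amulA (star (val t))) -/Q -(amulA Q) (amulA Q Q) QQ.
- move=> x; set Q := star _ ** _ in QQ Qp *.
  by rewrite /= (amulA (star (val t))) -/Q Qp -!(amulA p) (amulA Q Q) QQ.
Qed.

Lemma half_standard_pi y : half_standard P T y -> y ** (star y ** y) = y.
Proof.
case=> a [p Pp ->]; have [p1 [Pp1 -> p1E _]] := half_standard_source a Pp.
have := p1E p1; rewrite (Pidem Pp1) star_lmul1 Pstar// rmul1_starA => ->.
by rewrite lmul1A !Pidem.
Qed.

(** Relation (v) extended to T_1 and to a right factor p, which moves past beta^*. Of a minimal
    extension only the equation b alpha = a beta is kept. *)
Lemma lmul1_star_lmul1 b a p : P p ->
  exists cs : seq (option T * X * option T),
    (forall c, c \in cs -> P c.1.2 /\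
       exists2 u, mul b c.1.1 = Some u & mul a c.2 = Some u) /\
    lmul1_star b (lmul1 a p) =
      \sum_(c <- cs) standard_word c.1.1 c.1.2 c.2.
Proof.
move=> Pp; case: b => [b|]; last first.
  exists [:: (a, p, None)]; rewrite big_seq1; split=> // c.
  rewrite inE => /eqP -> /=; split=> //; exists a => //.
  by case: (a).
case: a => [a|]; last first.
  have [q Pq pq] := P_rmul1_star (Some b) Pp.
  (* [P_rmul1_star] moves p past b^* behind a left factor; the factor Q_b is harmless, as Q_b b^* =
     b^*. *)
  exists [:: (None, star (val b) ** val b ** q, Some b)]; split.
    move=> c; rewrite inE => /eqP ->; split => /=; last by exists (Some b).
    by apply: (sga_Pmul sgaX) => //; exact: source_proj_P.
  rewrite big_seq1 /standard_word /=.
  have [_ tpi] := sga_Tpi sgaX (set_mem (valP b)).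
  by rewrite -[RHS]pq /= -{1}tpi !starM starK amulA.
have [q [Pq baE]] := sga_TT sgaX b a.
have /choice[f fP] : forall s, exists r,
    P r /\ forall x, rmul1_star x s ** p = rmul1_star (x ** r) s.
  by move=> s; have [r] := P_rmul1_star s Pp; exists r.
set M := min_ext _ _ _ _ in q Pq baE.
exists [seq (ab.1, q ab ** f ab.2, ab.2) |
  ab <- finite_support 0 M (fun ab => standard_word ab.1 (q ab) ab.2)].
split.
  move=> _ /mapP[ab + ->] /=; case: finite_supportP => // S SM _ _ /SM abM.
  have [u [bu au _]] := abM; have [Pf _] := fP ab.2.
  by split; [exact: (sga_Pmul sgaX) (Pq _ abM) Pf | exists u].
rewrite /= amulA baE amul_suml big_map /=; apply: eq_bigr => ab _.
by rewrite /standard_word (fP _).2 lmul1A.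
Qed.

(** The middle t^* s' p' is expanded and p moves past alpha. The outer products s alpha and t' beta
    stay unevaluated, since they may be undefined. *)
Lemma mul_standard_word s p t s' p' t' : P p -> P p' ->
  exists cs : seq (option T * X * option T),
    (forall c, c \in cs -> P c.1.2 /\
       exists2 u, mul t c.1.1 = Some u & mul s' c.2 = Some u) /\
    standard_word s p t ** standard_word s' p' t' =
      \sum_(c <- cs)
        rmul1_star (rmul1_star (lmul1 s (lmul1 c.1.1 c.1.2)) c.2) t'.
Proof.
move=> Pp Pp'; have [cs [csP csE]] := lmul1_star_lmul1 t s' Pp'.
have /choice[f fP] : forall b, exists r,
    P r /\ forall x, p ** lmul1 b x = lmul1 b (r ** x).
  by move=> b; have [r] := P_lmul1 b Pp; exists r.
exists [seq (c.1.1, f c.1.1 ** c.1.2, c.2) | c <- cs]; split.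
  move=> _ /mapP[c /csP[Pc bc] ->]; split=> //=.
  by apply: (sga_Pmul sgaX) => //; case: (fP c.1.1).
rewrite /standard_word amul_rmul1_star rmul1_starA csE lmul1A amul_sumr.
rewrite lmul1_sum rmul1_star_sum big_map; apply: eq_bigr => c _ /=.
by rewrite /standard_word amul_rmul1_star (fP _).2 !rmul1_star_lmul1.
Qed.

Lemma range_proj_lmul1 a p : P p ->
  range_proj (lmul1 a p) = standard_word a p a.
Proof.
by move=> Pp; rewrite /range_proj star_lmul1 Pstar// amul_rmul1_star lmul1A
  Pidem.
Qed.

Lemma star_standard_word s p t : P p ->
  star (standard_word s p t) = standard_word t p s.
Proof.
by move=> Pp; rewrite /standard_word star_rmul1_star star_lmul1 Pstar//
  rmul1_star_lmul1.
Qed.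

Lemma rmul1_star_rmul1_star s t u x : mul s t = Some u ->
  rmul1_star (rmul1_star x t) s = rmul1_star x u.
Proof.
move=> st; have := congr1 (@star R X) (lmul1_lmul1 (star x) st).
by rewrite !star_lmul1 starK.
Qed.

Lemma rmul1_star_rmul1_star_eq0 s t x : mul s t = None ->
  rmul1_star (rmul1_star x t) s = 0.
Proof.
move=> st; have := congr1 (@star R X) (lmul1_lmul1_eq0 (star x) st).
by rewrite !star_lmul1 starK star0.
Qed.

(** Here a alpha = b beta = u in every term, so the product is a sum of words u r u^* and thus
    self-adjoint; taking adjoints swaps the two projections. *)
Lemma range_projC x y : half_standard P T x -> half_standard P T y ->
  range_proj x ** range_proj y = range_proj y ** range_proj x.
Proof.
move=> [a [p Pp ->]] [b [q Pq ->]]; rewrite !range_proj_lmul1//.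
have [cs [csP csE]] := mul_standard_word a a b b Pp Pq.
suff : star (standard_word a p a ** standard_word b q b) =
    standard_word a p a ** standard_word b q b.
  by rewrite starM !star_standard_word.
rewrite csE star_sum; apply: eq_big_seq => c /csP[Pc [u ac bc]].
rewrite (lmul1_lmul1 _ ac) (rmul1_star_rmul1_star _ bc).
exact: star_standard_word.
Qed.

(** * Homogeneous sums of standard words *)

Definition graded_sum (n : k -> int) x :=
  exists cs : seq (option T * X * option T),
    (forall c, c \in cs -> P c.1.2 /\
       forall i, (deg1 d c.1.1 i)%:Z - (deg1 d c.2 i)%:Z = n i) /\
    x = \sum_(c <- cs) standard_word c.1.1 c.1.2 c.2.

Lemma graded_sum_word s p t : P p ->
  graded_sum (fun i => (deg1 d s i)%:Z - (deg1 d t i)%:Z) (standard_word s p t).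
Proof.
move=> Pp; exists [:: (s, p, t)]; rewrite big_seq1; split=> // c.
by rewrite inE => /eqP ->.
Qed.

Lemma graded_sum0 n : graded_sum n 0.
Proof. by exists [::]; rewrite big_nil. Qed.

Lemma graded_sumD n x y :
  graded_sum n x -> graded_sum n y -> graded_sum n (x + y).
Proof.
move=> [cs [csP ->]] [cs' [csP' ->]]; exists (cs ++ cs'); rewrite big_cat;
  split=> //.
by move=> c; rewrite mem_cat => /orP[/csP|/csP'].
Qed.

(** The equation t alpha = s' beta between the inner letters makes the degrees add up. Undefined
    outer products give 0, which is homogeneous of every degree. *)
Lemma graded_sumM n x s p t : graded_sum n x -> P p ->
  graded_sum (fun i => n i + ((deg1 d s i)%:Z - (deg1 d t i)%:Z))
    (x ** standard_word s p t).
Proof.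
move=> [cs [csP ->]] Pp; rewrite amul_suml big_seq.
apply: big_ind => [||c /csP[Pc cn]]; [exact: graded_sum0|exact: graded_sumD|].
have [es [esP ->]] := mul_standard_word c.1.1 c.2 s t Pc Pp.
rewrite big_seq; apply: big_ind => [||e /esP[Pe [u ce se]]].
- exact: graded_sum0.
- exact: graded_sumD.
case ce1: (mul c.1.1 e.1.1) => [v|]; last first.
  by rewrite (lmul1_lmul1_eq0 _ ce1) !rmul1_star0; exact: graded_sum0.
case te : (mul t e.2) => [w|]; last first.
  by rewrite (rmul1_star_rmul1_star_eq0 _ te); exact: graded_sum0.
rewrite (lmul1_lmul1 _ ce1) (rmul1_star_rmul1_star _ te).
have := graded_sum_word v w Pe; congr graded_sum; apply/funext => i.
rewrite -cn (deg1_mul1 i ce1) (deg1_mul1 i te) !PoszD.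
have := deg1_mul1 i se; rewrite (deg1_mul1 i ce) => /(congr1 Posz).
by rewrite !PoszD; lia.
Qed.

(** * Products z (1 - P_{y_1}) ... (1 - P_{y_m}) with arbitrary z *)

Definition remove_ranges z (ys : seq X) :=
  foldl (fun z y => z - z ** range_proj y) z ys.

Lemma remove_rangesMl u z ys :
  u ** remove_ranges z ys = remove_ranges (u ** z) ys.
Proof. by elim: ys z => //= y ys IH z; rewrite IH amulBr amulA. Qed.

Lemma remove_rangesMr u z ys :
  (forall y, y \in ys -> u ** range_proj y = range_proj y ** u) ->
  remove_ranges z ys ** u = remove_ranges (z ** u) ys.
Proof.
elim: ys z => //= y ys IH z uys; rewrite IH => [|y' y'ys].
  by rewrite amulBl -!(amulA z) uys ?mem_head.
by rewrite uys ?in_cons ?y'ys ?orbT//.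
Qed.

Lemma remove_rangesM_fixed u z ys :
  (forall y, y \in ys -> range_proj y ** u = 0) ->
  remove_ranges z ys ** u = z ** u.
Proof.
elim: ys z => //= y ys IH z uys; rewrite IH => [|y' y'ys].
  by rewrite amulBl -!(amulA z) uys ?mem_head// amul0r subr0.
by rewrite uys ?in_cons ?y'ys ?orbT//.
Qed.

Lemma remove_ranges0 ys : remove_ranges 0 ys = 0.
Proof. by elim: ys => //= y ys IH; rewrite amul0l subr0. Qed.

(** Range projections commute, so z P_y = z survives each earlier factor until 1 - P_y annihilates
    the product. *)
Lemma remove_ranges_eq0 z y ys :
  (forall y', y' \in ys -> half_standard P T y') -> y \in ys ->
  z ** range_proj y = z -> remove_ranges z ys = 0.
Proof.
elim: ys z => // y' ys IH z hys; rewrite in_cons => /predU1P[<-|yys] zy /=.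
  by rewrite zy subrr remove_ranges0.
apply: IH => // [y'' y''ys|]; first by apply: hys; rewrite in_cons y''ys orbT.
have y'C : range_proj y' ** range_proj y = range_proj y ** range_proj y'.
  by apply: range_projC; apply: hys; rewrite ?mem_head// in_cons yys orbT.
by rewrite amulBl zy -(amulA z) y'C (amulA z (range_proj y)) zy.
Qed.

Lemma range_proj_idem y : half_standard P T y ->
  range_proj y ** range_proj y = range_proj y.
Proof. by move=> hy; rewrite /range_proj amulA -(amulA y) half_standard_pi. Qed.

Lemma star_range_proj y : star (range_proj y) = range_proj y.
Proof. by rewrite /range_proj starM starK. Qed.

Lemma remove_ranges_kill z y ys :
  (forall y', y' \in ys -> half_standard P T y') -> y \in ys ->
  remove_ranges z ys ** range_proj y = 0.
Proof.
move=> hys yys; rewrite remove_rangesMr => [|y' y'ys].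
  by apply: (@remove_ranges_eq0 _ y) => //;
    rewrite -(amulA z) range_proj_idem//; exact: hys.
by apply: range_projC; exact: hys.
Qed.

Lemma remove_ranges_star z ys : (forall y, y \in ys -> half_standard P T y) ->
  star z = z -> (forall y, y \in ys -> z ** range_proj y = range_proj y ** z) ->
  star (remove_ranges z ys) = remove_ranges z ys.
Proof.
elim: ys z => //= y ys IH z hys zz zys.
have yys : y \in y :: ys by rewrite mem_head.
have ysS y' : y' \in ys -> y' \in y :: ys by rewrite in_cons orbC => ->.
apply: IH => [y' /ysS /hys//||y' /ysS y'ys].
  by rewrite starB starM star_range_proj zz zys.
rewrite amulBl amulBr -(amulA z) (range_projC (hys _ yys) (hys _ y'ys)).
by rewrite (amulA z (range_proj y')) zys// (amulA (range_proj y') z).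
Qed.

(* p <= Q_a, stated so as to cover a = 1, where X has no unit to serve as Q_a *)
Definition source_of a p :=
  [/\ P p, forall x, lmul1_star a (lmul1 a (p ** x)) = p ** x &
      forall x, p ** lmul1_star a (lmul1 a x) = p ** x].

(** P_{a p} a z = a p a^* a z, and p <= Q_a absorbs a^* a. *)
Lemma range_proj_mul_lmul1 a p z : source_of a p ->
  range_proj (lmul1 a p) ** lmul1 a z = lmul1 a (p ** z).
Proof.
case=> Pp _ pE; rewrite /range_proj star_lmul1 Pstar// -(amulA (lmul1 a p)).
by rewrite rmul1_starA pE lmul1A amulA Pidem.
Qed.

(** * Freeness: removing smaller ranges leaves a nonzero remainder *)

Hypothesis freeX : free_semigraph_algebra P T.

Lemma range_proj_neq (t : T) p q : P p -> P q -> q <> 0 ->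
  range_proj (val t ** p) <> q.
Proof.
move=> Pp Pq q0 tpq; have [tP|tNP] := pselect (P (val t ** p)).
  have tpE : val t ** p = q by rewrite -tpq /range_proj Pstar// Pidem.
  apply: q0; apply: (mul_TP_in_P Pq Pp _ tpE) => dt.
  by have := @deg1_eq0 (Some t) dt.
apply: (freeX.1 (val t ** p)) tNP _; last by rewrite tpq.
by exists (Some t), p.
Qed.

Definition proper_in q c :=
  half_standard P T c /\ proj_lt (range_proj c) q.

Lemma proper_in_mul (t : T) p q : P p -> P q -> q <> 0 ->
  proper_in q (q ** (val t ** p)).
Proof.
move=> Pp Pq q0; have [r Pr rE] := P_lmul1 (Some t) Pq.
have rpP : P (r ** p) by exact: (sga_Pmul sgaX).
have qtE : q ** (val t ** p) = val t ** (r ** p) by exact: rE.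
split; first by rewrite qtE; exists (Some t), (r ** p).
split; last by rewrite qtE; exact: range_proj_neq.
by rewrite /proj_le /range_proj starM (Pstar Pq) -!amulA (Pidem Pq).
Qed.

(** The product (1 - P_{c_1}) ... (1 - P_{c_n}) q. *)
Definition compress q (cs : seq X) :=
  foldr (fun c z => z - range_proj c ** z) q cs.

Lemma compressM q cs : P q -> (forall c, c \in cs -> proper_in q c) ->
  q ** compress q cs = compress q cs.
Proof.
move=> Pq; elim: cs => [_|c cs IH csP] /=; first exact: Pidem.
have [|_ [cq _]] := csP c; first exact: mem_head.
have IHcs : q ** compress q cs = compress q cs.
  by apply: IH => c' c'cs; apply: csP; rewrite in_cons c'cs orbT.
rewrite amulBr IHcs (amulA q (range_proj c)); congr (_ - _ ** _).
have := congr1 (@star R X) cq.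
by rewrite starM star_range_proj Pstar.
Qed.

(** c^* (1 - P_c) = 0, and the factor 1 - P_c can be brought to the front because range projections
    commute. *)
Lemma compress_kill q cs c : (forall c, c \in cs -> half_standard P T c) ->
  c \in cs -> star c ** compress q cs = 0.
Proof.
have kill c' z : half_standard P T c' -> star c' ** range_proj c' = star c'.
  by move=> /half_standard_pi/(congr1 (@star R X));
    rewrite !starM starK /range_proj -amulA.
elim: cs => // c' cs IH csP; rewrite in_cons /= amulBr => /predU1P[->|ccs].
  by rewrite amulA kill ?subrr//; apply: csP; exact: mem_head.
have hc : half_standard P T c by apply: csP; rewrite in_cons ccs orbT.
have hc' : half_standard P T c' by apply: csP; exact: mem_head.
have IHcs : star c ** compress q cs = 0.
  by apply: IH => // c'' c''cs; apply: csP; rewrite in_cons c''cs orbT.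
rewrite IHcs -(kill c)// -(amulA (star c)) (amulA (range_proj c)).
rewrite (range_projC hc hc') -(amulA (range_proj c')) /range_proj -(amulA c).
by rewrite IHcs !amul0r subrr.
Qed.

(** As P_c q = P_c, removing P_c from q - V gives q - (P_c + V - P_c V). In this form part (ii) of
    freeness applies. *)
Lemma compressE q cs : (forall c, c \in cs -> proper_in q c) ->
  compress q cs = q - \big[@proj_join R X/0]_(c <- cs) range_proj c.
Proof.
elim: cs => [_|c cs IH csP] /=; first by rewrite big_nil subr0.
have [|_ [cq _]] := csP c; first exact: mem_head.
rewrite big_cons IH => [|c' c'cs]; last by apply: csP;
  rewrite in_cons c'cs orbT.
by rewrite amulBr cq /proj_join !opprD !opprK !addrA; congr (_ + _);
  rewrite addrAC.
Qed.

Lemma compress_neq0 q cs : P q -> q <> 0 ->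
  (forall c, c \in cs -> proper_in q c) -> compress q cs <> 0.
Proof.
move=> Pq q0 csP; have [->//|/eqP cs0] := eqVneq cs [::].
rewrite compressE//; have [_ neq] := freeX.2 q cs Pq cs0 csP.
by move/eqP; rewrite subr_eq0 eq_sym => /eqP.
Qed.

(* The list [cs] makes [P_y] vanish on [a (compress p cs)]. *)
Definition killers a p y (cs : seq X) :=
  (forall c, c \in cs -> proper_in p c) /\
  (forall g, p ** g = g -> (forall c, c \in cs -> star c ** g = 0) ->
     range_proj y ** lmul1 a g = 0).

Lemma ex_killers a p y : source_of a p -> p <> 0 -> half_standard P T y ->
  range_proj (lmul1 a p) ** range_proj y <> range_proj (lmul1 a p) ->
  exists cs, killers a p y cs.
Proof.
move=> [Pp pa pa'] p0 hy.
have hx : half_standard P T (lmul1 a p) by exists a, p.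
rewrite range_projC// => yx.
have [b [c Pc yE]] := hy.
have [c1 [Pc1 cc1 c1b c1b']] := half_standard_source b Pc.
rewrite cc1 in yE; have c1P : source_of b c1 by [].
(* If a = b s, then P_y acts on the image of a as some q in P, and q p alone is the list sought.
   Equality q p = p would give P_x <= P_y for x = a p. *)
have [[s bs]|Nbs] := pselect (exists s, mul b s = Some a).
  have [q Pq qE] := P_lmul1 s Pc1.
  have yaE z : range_proj y ** lmul1 a z = lmul1 a (q ** z).
    by rewrite yE -!(lmul1_lmul1 _ bs) range_proj_mul_lmul1// qE.
  exists [:: q ** p]; have Pqp : P (q ** p) by exact: (sga_Pmul sgaX).
  split=> [c'|g pg /(_ (q ** p)) /=]; last first.
    by rewrite yaE Pstar// -amulA pg => ->; rewrite ?mem_head ?lmul10.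
  rewrite inE => /eqP ->; split; first by exists None, (q ** p).
  rewrite /range_proj Pstar// Pidem//; split;
    first by rewrite /proj_le -amulA Pidem.
  by move=> qpp; apply: yx; rewrite /range_proj lmul1A yaE amulA qpp.
(* Otherwise beta = 1 cannot occur in b alpha = a beta. So every beta is in T, each p beta r is
   proper in p, and if its adjoint kills g, so does r beta^*. *)
have [cs [csP csE]] := lmul1_star_lmul1 b a Pp.
exists [seq p ** lmul1 e.2 e.1.2 | e <- cs];
  split=> [_ /mapP[e ecs ->]|g pg gcs].
  have [Pe [u be ae]] := csP e ecs.
  case e2: e.2 ae => [t|] ae; first exact: proper_in_mul.
  by case: Nbs; exists e.1.1; rewrite be -ae; case: (a).
rewrite yE {1}/range_proj star_lmul1 Pstar// -amulA rmul1_starA -{1}pg -lmul1A.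
rewrite -lmul1_starA csE amul_suml !amul_sumr big1_seq// => e /andP[_ ecs].
have [Pe _] := csP e ecs.
have := gcs (p ** lmul1 e.2 e.1.2) (map_f _ ecs).
rewrite starM star_lmul1 !Pstar// -amulA pg => eg.
by rewrite /standard_word rmul1_star_lmul1 !lmul1A eg lmul10 !amul0r lmul10.
Qed.

(** With b = p t r, P_{a b} a g = a b b^* a^* a g = a b b^* g since p <= Q_a; hence b itself is
    enough. *)
Lemma killers_mul a p (t : T) r : source_of a p -> p <> 0 -> P r ->
  killers a p (lmul1 a (p ** (val t ** r))) [:: p ** (val t ** r)].
Proof.
move=> [Pp pa pa'] p0 Pr; split=> [c|g pg /(_ (p ** (val t ** r)))].
  by rewrite inE => /eqP ->; exact: proper_in_mul.
rewrite mem_head => /(_ isT) tg;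
  rewrite /range_proj -amulA star_lmul1 rmul1_starA.
by rewrite -{1}pg pa pg tg amul0r.
Qed.

Lemma ex_killers_seq a p (ys : seq X) :
  (forall y, y \in ys -> exists cs, killers a p y cs) ->
  exists cs : seq X, (forall c, c \in cs -> proper_in p c) /\
    (forall g, p ** g = g -> (forall c, c \in cs -> star c ** g = 0) ->
     forall y, y \in ys -> range_proj y ** lmul1 a g = 0).
Proof.
elim: ys => [_|y ys IH ysP]; first by exists [::].
have [|cs1 [cs1P cs1K]] := ysP y; first exact: mem_head.
have [|cs2 [cs2P cs2K]] := IH.
  by move=> y' y'ys; apply: ysP; rewrite in_cons y'ys orbT.
exists (cs1 ++ cs2); split=> [c|g pg gcs y'].
  by rewrite mem_cat => /orP[/cs1P|/cs2P].
rewrite in_cons => /predU1P[->|].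
  by apply: cs1K => // c c1; apply: gcs; rewrite mem_cat c1.
by apply: cs2K => // c c2; apply: gcs; rewrite mem_cat c2 orbT.
Qed.

(** For g = [compress p cs] the removed ranges vanish on a g, so the remainder fixes a g. Were it 0,
    then a g = 0 and g = a^* a g = 0, against freeness. *)
Lemma remove_ranges_neq0 a p (ys : seq X) : source_of a p -> p <> 0 ->
  (forall y, y \in ys -> exists cs, killers a p y cs) ->
  remove_ranges (range_proj (lmul1 a p)) ys <> 0.
Proof.
move=> ap p0 ysP; have [Pp pa _] := ap.
have [cs [csP csK]] := ex_killers_seq ysP; pose g := compress p cs.
have pg : p ** g = g by exact: compressM.
have g0 : g <> 0 by exact: compress_neq0.
move=> q0; apply: g0; rewrite -pg -pa pg.
have -> : lmul1 a g = 0; last by rewrite lmul1_star0.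
rewrite -pg -range_proj_mul_lmul1// -(@remove_rangesM_fixed _ _ ys) ?q0
  ?amul0l//.
apply: csK => // c ccs; apply: compress_kill => // c' /csP.
by case.
Qed.

Lemma lmul1_half_standard a y : half_standard P T y ->
  half_standard P T (lmul1 a y) \/ lmul1 a y = 0.
Proof.
case=> s [p Pp ->]; case as_: (mul a s) => [u|].
  by left; rewrite (lmul1_lmul1 _ as_); exists u, p.
by right; exact: lmul1_lmul1_eq0.
Qed.

(** * Construction of the cancelling projection *)

Lemma free_cancelling : cancelling P d.
Proof.
move=> s t r Pr dst _ [x [ys [hx hys ->]]] p_neq0.
have [a [p0 Pp0 xE0]] := hx.
have [p [Pp xE pa pa']] := half_standard_source a Pp0.
rewrite xE in xE0; subst x; have ap : source_of a p by [].
rewrite -/(remove_ranges _ _) in p_neq0 *;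
  set e := remove_ranges _ _ in p_neq0 *.
have p1_neq0 : p <> 0.
  move=> p1_eq0; apply: p_neq0; rewrite /e p1_eq0 lmul10 /range_proj amul0l.
  exact: remove_ranges0.
(* Expansion of p a^* w a p; the degrees of a^* and a cancel, leaving d(s) - d(t). *)
have [cs [csP csE]] := graded_sumM a None
  (graded_sumM s t (graded_sum_word None a Pp) Pr) Pp.
(* For a summand alpha r beta^*, the range to remove comes from alpha, or from beta if alpha = 1.
   Nonzero degree excludes alpha = beta = 1. *)
pose v (c : option T * X * option T) :=
  lmul1 a (p ** lmul1 (if c.1.1 is Some _ then c.1.1 else c.2) c.1.2).
have csT c : c \in cs -> exists u, v c = lmul1 a (p ** (val (u : T) ** c.1.2)).
  move=> /csP[_]; rewrite /v; case: c.1.1 => [u|]; first by exists u.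
  case: c.2 => [u|]; first by exists u.
  move=> /= dc; case: dst; apply/funext => i; have := dc i; lia.
(* Each v c is half-standard or 0. Zero need not be half-standard, so only the half-standard ones
   are removed. *)
pose new := [seq y <- map v cs | `[< half_standard P T y >]].
pose q := remove_ranges (range_proj (lmul1 a p)) (ys ++ new).
have hnew y : y \in ys ++ new -> half_standard P T y.
  by rewrite mem_cat => /orP[/hys//|]; rewrite mem_filter => /andP[/asboolP].
have xC y : half_standard P T y ->
    range_proj (lmul1 a p) ** range_proj y =
    range_proj y ** range_proj (lmul1 a p).
  exact: range_projC.
have qv c : c \in cs -> q ** v c = 0.
  move=> ccs; have [u vE] := csT c ccs; have [Pc _] := csP c ccs.
  have hu : half_standard P T (p ** (val u ** c.1.2)).
    by have [] := proper_in_mul u Pc Pp p1_neq0.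
  have [hv|v0] := lmul1_half_standard a hu; last by rewrite vE v0 amul0r.
  rewrite -vE in hv; rewrite -(half_standard_pi hv) (amulA (v c)) amulA.
  rewrite (remove_ranges_kill _ hnew) ?amul0l// mem_cat mem_filter.
  by rewrite map_f// andbT; apply/orP; right; exact/asboolP.
have qstar : star q = q.
  apply: remove_ranges_star => // [|y /hnew]; first exact: star_range_proj.
  exact: xC.
have xq : range_proj (lmul1 a p) ** q = q.
  by rewrite remove_rangesMl range_proj_idem.
have qx : q ** range_proj (lmul1 a p) = q.
  by rewrite -{1}qstar -{1}star_range_proj -starM xq qstar.
(* Idempotence of e yields q <= e below, once e is moved past the new factors. *)
have ee : e ** e = e.
  rewrite {1}/e remove_rangesM_fixed; last first.
    move=> y yys; have := remove_ranges_kill (range_proj (lmul1 a p)) hys yys.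
    move/(congr1 (@star R X)); rewrite starM star_range_proj star0.
    rewrite remove_ranges_star//; first exact: star_range_proj.
    by move=> y' /hys; exact: xC.
  by rewrite remove_rangesMl range_proj_idem.
exists q; split.
- by exists (lmul1 a p), (ys ++ new).
- apply: remove_ranges_neq0 => // y; rewrite mem_cat => /orP[yys|].
    apply: ex_killers => //; first exact: hys.
    (* P_x <= P_y for some y in [ys] would make the given projection 0. *)
    move=> xy; apply: p_neq0; exact: (remove_ranges_eq0 hys yys).
  rewrite mem_filter => /andP[_ /mapP[c ccs ->]].
  have [u ->] := csT c ccs; have [Pc _] := csP c ccs.
  by eexists; exact: killers_mul.
- rewrite /proj_le /q /remove_ranges foldl_cat -!/(remove_ranges _ _).
  rewrite -/e remove_rangesMr ?ee// => y ynew.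
  have hy : half_standard P T y by apply: hnew; rewrite mem_cat ynew orbT.
  rewrite remove_rangesMr ?remove_rangesMl ?xC// => y' /hys hy'.
  exact: range_projC.
(* Inserting P_x on both sides of w exposes p a^* w a p between q a p and p a^* q. *)
rewrite -{1}qx -{2}xq /range_proj star_lmul1 Pstar//.
have -> : q ** (lmul1 a p ** rmul1_star p a) ** standard_word s r t **
    (lmul1 a p ** rmul1_star p a ** q) =
  q ** lmul1 a p ** (standard_word None p a ** standard_word s r t **
    standard_word a p None) ** rmul1_star p a ** q.
  by rewrite /standard_word /= !amulA.
rewrite csE amul_sumr !amul_suml big1_seq// => c /andP[_ ccs].
have [Pc _] := csP c ccs; have := qv c ccs; rewrite /v.
case c1E: c.1.1 => [u|] qc.
  rewrite /standard_word -!amulA rmul1_starA (amulA (lmul1 a p)) lmul1A amulA.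
  by rewrite qc amul0l.
(* Now alpha = 1 and v is built from beta, so the right-hand q kills the summand: this is the
   adjoint of q v = 0. *)
rewrite -!amulA; suff -> : standard_word None c.1.2 c.2 **
    (rmul1_star p a ** q) = 0 by rewrite !amul0r.
apply: (can_inj (@starK R X)); rewrite !starM star_standard_word//.
rewrite star_rmul1_star (Pstar Pp) qstar star0 -amulA lmul1A.
exact: qc.
Qed.

End SemigraphAlgebraFacts.

Theorem proposition3p10 (R : realType) (k : Type) (X : starAlgType R)
    (P T : set X) (d : T -> k -> nat) :
  semigraph_algebra P d -> free_semigraph_algebra P T -> cancelling P d.
Proof. exact: free_cancelling. Qed.
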